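(* For every balanced LTF $f$ on $k\leq 4$ variables, $\textsf{Max-CSP}(f)$ is sketching approximable in $O(\log(n))$ space.
   Context: For $z\in\mathbb{R}$, $\textsf{sign}(z)=1$ if $z>0$ and $\textsf{sign}(z)=0$ if $z\le 0$. A linear threshold function (LTF) is $f:\{-1,1\}^k\to\{0,1\}$ of the form $f(x)=\textsf{sign}(\sum_{i=1}^k w_ix_i+\theta)$ with $w_i,\theta\in\mathbb{R}$. A balanced LTF is an LTF with $\theta=0$ such that $\sum_{i=1}^k w_ix_i\neq 0$ for every $x\in\{-1,1\}^k$. For $f:\{-1,1\}^k\to\{0,1\}$, an instance $\Psi$ of $\textsf{Max-CSP}(f)$ on Boolean variables $X_1,\dots,X_n\in\{-1,1\}$ consists of $m$ constraints, each applying $f$ to a sequence of $k$ literals on $k$ distinct variables (a literal being $X_j$ or $-X_j$); $\textsf{val}_\Psi$ is the maximum over assignments of the fraction of satisfied constraints. Let $\rho(f)=2^{-k}|\{x\in\{-1,1\}^k: f(x)=1\}|$. For $0\le\beta<\gamma\le 1$, $(\gamma,\beta)$-$\textsf{Max-CSP}(f)$ is the promise problem of deciding, given $\Psi$ with $\textsf{val}_\Psi\ge\gamma$ or $\textsf{val}_\Psi<\beta$, which holds. Inputs arrive as a stream of constraints; a sketching algorithm is a randomized streaming algorithm using space $s(n)$ whose state (sketch) is composable: for fixed randomness, the sketch of a concatenation of two streams is determined by the sketches of the two streams. It solves a problem if it answers correctly with probability at least $2/3$ on every input. $\textsf{Max-CSP}(f)$ is sketching approximable in space $s(n)$ if there exist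 $\epsilon>0$ and a sketching algorithm using space $s(n)$ solving $(1-\epsilon,\rho(f)+\epsilon)$-$\textsf{Max-CSP}(f)$.
   Formalization: The number m of constraints is assumed positive and at most c·n^c, for an arbitrary fixed c; the algorithm and the constant in O(log n) may depend on c, but ε may not. With m unrestricted the claim is false. *)

(* Defs.v *)
From HB Require Import structures.
From mathcomp Require Import all_boot all_order all_algebra.
From mathcomp Require Import all_classical all_reals all_analysis.

Set Implicit Arguments.
Unset Strict Implicit.
Unset Printing Implicit Defensive.

Import Order.TTheory GRing.Theory Num.Theory.
Import numFieldNormedType.Exports.

Local Open Scope classical_set_scope.
Local Open Scope ring_scope.

(** * Predicates on the cube {-1,1}^k

    A point of {-1,1}^k is an element of [cube k]; [true] stands for 1 and
    [false] for -1, so that changing sign is boolean negation. *)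

Definition cube (k : nat) := {ffun 'I_k -> bool}.

Definition pm1 (R : realType) (b : bool) : R := if b then 1 else -1.

Definition sign01 (R : realType) (z : R) : bool := 0 < z.

Definition linear_form (R : realType) (k : nat) (w : 'I_k -> R) (x : cube k) : R :=
  \sum_(i < k) w i * pm1 R (x i).

Definition LTF_with (R : realType) (k : nat) (w : 'I_k -> R) (theta : R)
    (f : cube k -> bool) : Prop :=
  forall x : cube k, f x = sign01 (linear_form w x + theta).

Definition balancedLTF (R : realType) (k : nat) (f : cube k -> bool) : Prop :=
  exists w : 'I_k -> R,
    LTF_with w 0 f /\ forall x : cube k, linear_form w x <> 0.

Definition rho (R : realType) (k : nat) (f : cube k -> bool) : R :=
  #|[pred x : cube k | f x]|%:R / 2 ^+ k.

(** * Instances of Max-CSP(f) on variables X_0, ..., X_(n-1) *)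

(** [(j, false)] is the literal X_j and [(j, true)] is the literal -X_j. *)
Definition literal (n : nat) := ('I_n * bool)%type.

Definition literal_value (n : nat) (a : cube n) (l : literal n) : bool :=
  if l.2 then ~~ a l.1 else a l.1.

Definition constraint (k n : nat) :=
  {c : {ffun 'I_k -> literal n} | injectiveb (fun i : 'I_k => (c i).1)}.

Definition satisfied (k n : nat) (f : cube k -> bool) (a : cube n)
    (c : constraint k n) : bool :=
  f [ffun i => literal_value a (val c i)].

(** Meaningful for nonempty [Psi] only. *)
Definition csp_val (R : realType) (k n : nat) (f : cube k -> bool)
    (Psi : seq (constraint k n)) : R :=
  (\max_(a : cube n) count (satisfied f a) Psi)%N%:R / (size Psi)%:R.

(** * Sketching algorithms *)

Definition run (In St : Type) (init : St) (step : St -> In -> St) (s : seq In) : St :=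
  foldl step init s.

(** An algorithm for streams of constraints on [n] variables.  Its randomness is
    a uniform string of [seed_bits] bits, drawn once; [sketch_comb] says that,
    the seed being fixed, the sketch of a concatenation is a function of the
    two sketches. *)
Record sketching_algorithm (k n : nat) := SketchingAlgorithm {
  seed_bits : nat;
  state_bits : nat;
  alg_init : seed_bits.-tuple bool -> state_bits.-tuple bool;
  alg_step : seed_bits.-tuple bool -> state_bits.-tuple bool -> constraint k n ->
    state_bits.-tuple bool;
  alg_answer : seed_bits.-tuple bool -> state_bits.-tuple bool -> bool;
  alg_comb : seed_bits.-tuple bool -> state_bits.-tuple bool ->
    state_bits.-tuple bool -> state_bits.-tuple bool;
  sketch_comb : forall (r : seed_bits.-tuple bool) (s t : seq (constraint k n)),
    run (alg_init r) (alg_step r) (s ++ t) =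
    alg_comb r (run (alg_init r) (alg_step r) s) (run (alg_init r) (alg_step r) t)
}.

(** The seed is available throughout the stream, so it is charged as memory. *)
Definition alg_space (k n : nat) (A : sketching_algorithm k n) : nat :=
  (seed_bits A + state_bits A)%N.

Definition alg_output (k n : nat) (A : sketching_algorithm k n)
    (r : (seed_bits A).-tuple bool) (Psi : seq (constraint k n)) : bool :=
  alg_answer r (run (alg_init r) (alg_step r) Psi).

Definition prob_output (R : realType) (k n : nat) (A : sketching_algorithm k n)
    (Psi : seq (constraint k n)) (b : bool) : R :=
  #|[pred r : (seed_bits A).-tuple bool | alg_output r Psi == b]|%:R
    / 2 ^+ seed_bits A.

(** [A] solves (gamma,beta)-Max-CSP(f) on instances with at most [M] constraints;
    the answer [true] means val >= gamma, the answer [false] means val < beta. *)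
Definition solves (R : realType) (k n : nat) (f : cube k -> bool) (gamma beta : R)
    (M : nat) (A : sketching_algorithm k n) : Prop :=
  forall Psi : seq (constraint k n), (0 < size Psi <= M)%N ->
    (gamma <= csp_val R f Psi -> 2 / 3 <= prob_output R A Psi true) /\
    (csp_val R f Psi < beta -> 2 / 3 <= prob_output R A Psi false).

(** Sketching approximability in space O(g(n)).  The number m of constraints is
    polynomial in n, the usual convention under which space is measured in terms
    of n alone: a fixed number of states cannot handle streams of unbounded
    length (already for k = 1, the monoid of sketches being finite, arbitrarily
    unbalanced multiplicities of X_1 and -X_1 are confused).  Every polynomial
    bound c * n ^ c is allowed, with [eps] independent of [c]. *)
Definition sketching_approximable_O (R : realType) (k : nat) (f : cube k -> bool)
    (g : nat -> R) : Prop :=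
  exists eps : R,
    [/\ 0 < eps, rho R f + eps < 1 - eps &
      forall c : nat, exists s : nat -> nat,
        (fun n => (s n)%:R : R) =O_\oo g /\
        exists A : forall n : nat, sketching_algorithm k n,
          forall n : nat, (alg_space (A n) <= s n)%N /\
            solves f (1 - eps) (rho R f + eps) (c * n ^ c)%N (A n)].

(* Main.v *)
(** Write B_j for the signed weight with which X_j occurs in the instance, the
    position i of a constraint carrying the integer weight lam_i.  For k <= 4 the
    weights can be chosen so that sum_j |B_j| >= (2 - O(eps)) m when the value is at
    least 1 - eps, while sum_j |B_j| >= (4/3 + delta) m already forces a value above
    1/2 + delta/36: set X_j to the sign of B_j with probability 2/3, independently.
    It thus suffices to estimate the l1 norm of the vector B.

    Over Z/N with N = 2W, let the Y_j be independent with the Fejer kernel as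
    distribution, so that E exp(2 pi i v Y_j / N) = 1 - |v|/W for |v| <= W.  The
    linear sketch sum_j B_j Y_j then satisfies
    E cos(2 pi q (sum_j B_j Y_j) / N) = prod_j (1 - q |B_j| / W),
    which reveals the l1 norm once q is of order W/m.  A constant number of copies
    gives constant error by Chebyshev.  The long random string is replaced by one
    drawn from a polynomial-size list that works for all streams (Newman), so that
    seed and state take O(log n) bits. *)
Require Import Defs.
From HB Require Import structures.
From mathcomp Require Import all_boot all_order all_algebra.
From mathcomp Require Import all_classical all_reals all_analysis.
From mathcomp Require Import complex.
From mathcomp Require Import ring lra zify.
Set Implicit Arguments.
Unset Strict Implicit.
Unset Printing Implicit Defensive.
Import Order.TTheory GRing.Theory Num.Theory.
Import numFieldNormedType.Exports.
Local Open Scope classical_set_scope.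
Local Open Scope ring_scope.
Local Open Scope complex_scope.

(** * Characters of Z/N and the Fejer kernel *)

(** A [2 ^ e]-th root of -1 has order dividing [2 ^ e.+1] but not [2 ^ e]. *)
Lemma exists_primitive_root_pow2 (C : numClosedFieldType) (e : nat) :
  exists w : C, (2 ^ e.+1).-primitive_root w.
Proof.
have e0 : (0 < 2 ^ e)%N by rewrite expn_gt0.
pose w : C := (2 ^ e).-root (-1); exists w.
have wE : w ^+ (2 ^ e) = -1 by rewrite /w rootCK.
have w1 : w ^+ (2 ^ e.+1) = 1 by rewrite expnS mulnC exprM wE sqrrN expr1n.
have [m prim_m dvd_m] := prim_order_exists (expn_gt0 2 e.+1) w1.
have /dvdn_pfactor[//|j lej mE] := dvd_m.
move: lej; rewrite leq_eqVlt ltnS => /orP[/eqP <-|je]; first by rewrite -mE.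
have : w ^+ (2 ^ e) = 1.
  by apply/eqP; rewrite -(prim_order_dvd prim_m) mE dvdn_exp2l.
by rewrite wE => /eqP; rewrite eq_sym -subr_eq0 opprK -mulr2n pnatr_eq0.
Qed.

Definition Zp_char (F : pzRingType) (N : nat) (w : F) (a : 'Z_N) : F := w ^+ a.

Lemma Zp_charD (F : nzRingType) (N : nat) (w : F) (a b : 'Z_N) :
  (1 < N)%N -> N.-primitive_root w ->
  Zp_char w (a + b) = Zp_char w a * Zp_char w b.
Proof.
move=> N1 prim_w; rewrite /Zp_char -exprD -[RHS](prim_expr_mod prim_w).
by congr (_ ^+ (_ %% _)%N); exact: Zp_cast.
Qed.

Lemma Zp_char_sum (F : nzRingType) (N : nat) (w : F) (I : finType) (a : I -> 'Z_N) :
  (1 < N)%N -> N.-primitive_root w ->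
  Zp_char w (\sum_i a i) = \prod_i Zp_char w (a i).
Proof.
move=> N1 prim_w; apply: (big_morph (Zp_char w)) => [x y|]; last exact: expr0.
exact: Zp_charD.
Qed.

(** Orthogonality of characters: the shift [a -> a + 1] multiplies the sum by [Zp_char w v], which
    differs from 1 when [v] is nonzero. *)
Lemma sum_Zp_char (F : idomainType) (N : nat) (w : F) (v : 'Z_N) :
  (1 < N)%N -> N.-primitive_root w ->
  \sum_(a : 'Z_N) Zp_char w (a * v) = if v == 0 then N%:R else 0.
Proof.
move=> N1 prim_w; case: eqP => [->|/eqP v0].
  rewrite (eq_bigr (fun=> 1)) => [|a _]; last by rewrite mulr0 /Zp_char expr0.
  by rewrite sumr_const card_ord Zp_cast.
have chi_v : Zp_char w v != 1.
  apply: contra v0; rewrite /Zp_char -(expr0 w) (eq_prim_root_expr prim_w).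
  by rewrite mod0n modn_small -?val_eqE // -{2}(Zp_cast N1).
have : (Zp_char w v - 1) * \sum_a Zp_char w (a * v) = 0.
  rewrite mulrBl mul1r mulr_sumr [X in _ - X](reindex_inj (addIr 1)) /=.
  apply/eqP; rewrite subr_eq0; apply/eqP; apply: eq_bigr => a _.
  by rewrite mulrDl mul1r addrC Zp_charD.
by move/eqP; rewrite mulf_eq0 subr_eq0 (negbTE chi_v) => /eqP.
Qed.

Definition fejer_sum (R : realType) (N W : nat) (w : R[i]) (a : 'Z_N) : R[i] :=
  \sum_(u < W) Zp_char w (a * u%:R).

(** A squared modulus is nonnegative; the factor [1 / (N * W)] normalises the total mass to 1. *)
Definition fejer (R : realType) (N W : nat) (w : R[i]) (a : 'Z_N) : R :=
  complex.Re (fejer_sum W w a * (fejer_sum W w a)^*%R) / (N * W)%:R.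

Lemma fejer_ge0 (R : realType) (N W : nat) (w : R[i]) (a : 'Z_N) :
  0 <= fejer W w a.
Proof.
by rewrite divr_ge0 //; move: (mul_conjC_ge0 (fejer_sum W w a)); rewrite lecE => /andP[].
Qed.

Lemma Zp_char_norm (C : numClosedFieldType) (N : nat) (w : C) (a : 'Z_N) :
  (1 < N)%N -> N.-primitive_root w -> `|Zp_char w a| = 1.
Proof.
move=> N1 prim_w; rewrite normrX (_ : `|w| = 1) ?expr1n //.
apply/eqP; rewrite -(@pexpr_eq1 _ _ N) ?(ltnW N1) //.
by rewrite -normrX (prim_expr_order prim_w) normr1.
Qed.

Lemma Zp_char_conj (R : realType) (N : nat) (w : R[i]) (a : 'Z_N) :
  (1 < N)%N -> N.-primitive_root w -> (Zp_char w a)^*%R = Zp_char w (- a).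
Proof.
move=> N1 prim_w; have chi_norm := Zp_char_norm a N1 prim_w.
have chi0 : Zp_char w a != 0 by rewrite -normr_eq0 chi_norm oner_eq0.
apply: (mulfI chi0); rewrite -Zp_charD // subrr [RHS]expr0.
by rewrite -normCK chi_norm expr1n.
Qed.

Lemma Zp_nat_inj (N m n : nat) :
  (m < N)%N -> (n < N)%N -> (m%:R == n%:R :> 'Z_N) = (m == n).
Proof.
move=> mN nN; apply/eqP/eqP => [|-> //].
have [N1|] := ltnP 1 N; last by case: N mN nN => [|[]] //; case: m n => [|m] [].
by move/(congr1 val); rewrite /= !val_Zp_nat // !modn_small.
Qed.

(** Expanding the square and applying orthogonality leaves the pairs with [u + z = u'] modulo [N].
    All indices involved stay below [2W = N], so nothing wraps around and [W - |z|] pairs remain. *)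
Lemma fejer_char (R : realType) (N W : nat) (w : R[i]) (z : int) :
  N = W.*2 -> (0 < W)%N -> N.-primitive_root w -> (`|z| <= W)%N ->
  \sum_(a : 'Z_N) (fejer W w a)%:C * Zp_char w (a * z%:~R)
    = (1 - `|z|%:R / W%:R)%:C.
Proof.
move=> NE W0 prim_w zW; have N1 : (1 < N)%N by rewrite NE; lia.
have N0 : (N%:R : R[i]) != 0 by rewrite pnatr_eq0; lia.
have W0' : (W%:R : R[i]) != 0 by rewrite pnatr_eq0; lia.
pose c : R[i] := (N * W)%:R^-1.
have numE (a : 'Z_N) : fejer_sum W w a * (fejer_sum W w a)^*%R =
    \sum_(u < W) \sum_(u' < W) Zp_char w (a * (u%:R - u'%:R)).
  rewrite rmorph_sum mulr_suml; apply: eq_bigr => u _.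
  rewrite mulr_sumr; apply: eq_bigr => u' _.
  by rewrite [X in _ * X]Zp_char_conj // -Zp_charD // mulrBr.
have fejerE (a : 'Z_N) : (fejer W w a)%:C =
    (\sum_(u < W) \sum_(u' < W) Zp_char w (a * (u%:R - u'%:R))) * c.
  rewrite /fejer rmorphM fmorphV /= rmorph_nat RRe_real ?numE //.
  by rewrite -numE ger0_real // mul_conjC_ge0.
have -> : \sum_(a : 'Z_N) (fejer W w a)%:C * Zp_char w (a * z%:~R) =
  (\sum_(u < W) \sum_(u' < W) if u%:R + z%:~R == u'%:R :> 'Z_N then N%:R else 0)
    * c.
  under eq_bigr => a _ do rewrite fejerE mulrAC mulr_suml.
  rewrite -mulr_suml exchange_big; congr (_ * c); apply: eq_bigr => u _.
  under eq_bigr => a _ do rewrite mulr_suml.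
  rewrite exchange_big; apply: eq_bigr => u' _.
  under eq_bigr => a _ do rewrite -Zp_charD // -mulrDr.
  by rewrite sum_Zp_char // addrAC subr_eq0.
have count_eq d : (d <= W)%N ->
    \sum_(u < W) \sum_(u' < W)
      (if (u + d)%:R == u'%:R :> 'Z_N then N%:R else 0 : R[i]) = (N * (W - d))%:R.
  move=> dW; rewrite (eq_bigr (fun u : 'I_W => if (u + d < W)%N then N%:R else 0)).
    rewrite -big_mkcond sumr_const -[LHS]mulr_natr -natrM; congr (_ * _)%:R.
    rewrite -sum1_card.
    rewrite (eq_bigl (fun u : 'I_W => (u < W - d)%N)); last first.
      by move=> u; rewrite unfold_in ltn_subRL addnC.
    by rewrite (big_ord_narrow (leq_subr d W)) sum1_card card_ord.
  move=> u _; case: ltnP => [udW|Wud].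
    rewrite (bigD1 (Ordinal udW)) //= eqxx big1 ?addr0 // => u' u'_neq.
    rewrite Zp_nat_inj; [|lia|by rewrite NE; have := ltn_ord u'; lia].
    by rewrite eq_sym -[X in _ == X]/(val (Ordinal udW)) val_eqE (negbTE u'_neq).
  rewrite big1 // => u' _; rewrite Zp_nat_inj.
  - by case: eqP => // ud; have := ltn_ord u'; rewrite -ud ltnNge Wud.
  - by rewrite NE; have := ltn_ord u; lia.
  - by rewrite NE; have := ltn_ord u'; lia.
have total : \sum_(u < W) \sum_(u' < W)
    (if u%:R + z%:~R == u'%:R :> 'Z_N then N%:R else 0 : R[i])
    = (N * (W - `|z|))%:R.
  case: z zW => d /= dW.
    rewrite -count_eq //; apply: eq_bigr => u _; apply: eq_bigr => u' _.
    by rewrite natrD.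
  (* For negative [z] the roles of [u] and [u'] are exchanged. *)
  rewrite -count_eq // exchange_big; apply: eq_bigr => u _; apply: eq_bigr => u' _.
  by rewrite NegzE mulrNz subr_eq eq_sym natrD.
have -> : (1 - `|z|%:R / W%:R : R)%:C = 1 - `|z|%:R / W%:R.
  by rewrite rmorphB rmorph1 fmorph_div /= !rmorph_nat.
rewrite total /c !natrM natrB //.
by field; rewrite N0 W0'.
Qed.

Lemma sum_fejer (R : realType) (N W : nat) (w : R[i]) :
  N = W.*2 -> (0 < W)%N -> N.-primitive_root w -> \sum_(a : 'Z_N) fejer W w a = 1.
Proof.
move=> NE W0 prim_w; have := fejer_char (z := 0) NE W0 prim_w (leq0n W).
rewrite mul0r subr0 => E; apply: complexI; rewrite -E rmorph_sum.
by apply: eq_bigr => a _; rewrite mulr0z mulr0 /Zp_char expr0 mulr1.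
Qed.

(** The character turns the sum over [i] into a product, and by independence the expectation factors
    into the coefficients of [fejer_char]. *)
Lemma fejer_expectation (R : realType) (N W : nat) (w : R[i]) (I : finType)
    (z : I -> int) :
  N = W.*2 -> (0 < W)%N -> N.-primitive_root w -> (forall i, (`|z i| <= W)%N) ->
  \sum_(X : {ffun I -> 'Z_N}) (\prod_i fejer W w (X i)) *
      complex.Re (Zp_char w (\sum_i X i * (z i)%:~R))
    = \prod_i (1 - `|z i|%:R / W%:R).
Proof.
move=> NE W0 prim_w zW; have N1 : (1 < N)%N by rewrite NE; lia.
have ReE (x : R) (y : R[i]) : x * complex.Re y = complex.Re (x%:C * y).
  by case: y => a b /=; rewrite mul0r subr0.
rewrite (eq_bigr (fun X : {ffun I -> 'Z_N} => complex.Re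
    ((\prod_i fejer W w (X i))%:C * \prod_i Zp_char w (X i * (z i)%:~R)))); last first.
  by move=> X _; rewrite -Zp_char_sum // -ReE.
rewrite -raddf_sum /=.
rewrite (_ : \sum_(X : {ffun I -> 'Z_N}) _ =
    \prod_i \sum_(a : 'Z_N) (fejer W w a)%:C * Zp_char w (a * (z i)%:~R)).
  under eq_bigr => i _ do rewrite fejer_char //.
  by rewrite -rmorph_prod.
rewrite bigA_distr_bigA; apply: eq_bigr => X _.
by rewrite rmorph_prod -big_split.
Qed.

(** * Probabilistic tools *)

Lemma sum_prod_weights (R : comPzRingType) (I J : finType) (mu : J -> R) :
  \sum_(j : J) mu j = 1 -> \sum_(f : {ffun I -> J}) \prod_i mu (f i) = 1.
Proof. by move=> mu1; rewrite -(bigA_distr_bigA (fun=> mu)) big1. Qed.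

Lemma sum_prod_weights_fun (R : comPzRingType) (I J : finType) (mu : J -> R)
    (g : I -> J -> R) :
  \sum_(f : {ffun I -> J}) (\prod_i mu (f i)) * \prod_i g i (f i) =
  \prod_i \sum_j mu j * g i j.
Proof.
rewrite bigA_distr_bigA; apply: eq_bigr => f _.
by rewrite -big_split.
Qed.

(** Cross terms vanish by independence and zero mean; each diagonal term is at most [v]. *)
Lemma second_moment_copies (R : numDomainType) (I J : finType) (mu h : J -> R) (v : R) :
  (forall j, 0 <= mu j) -> \sum_j mu j = 1 -> \sum_j mu j * h j = 0 ->
  (forall j, h j ^+ 2 <= v) ->
  \sum_(f : {ffun I -> J}) (\prod_i mu (f i)) * (\sum_i h (f i)) ^+ 2 <= #|I|%:R * v.
Proof.
move=> mu0 mu1 h0 hv.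
(* Writes [h (f a) * h (f b)] as a product over all coordinates, so that the sum over [f]
   factors. *)
pose g (a b i : I) (j : J) := (if i == a then h j else 1) * (if i == b then h j else 1).
have gE a b (f : {ffun I -> J}) : h (f a) * h (f b) = \prod_i g a b i (f i).
  rewrite big_split /= -!big_mkcond /= !big_pred1_eq. by [].
under eq_bigr => f _ do rewrite expr2 mulr_suml mulr_sumr.
rewrite exchange_big /= mulr_natl -sumr_const; apply: ler_sum => a _.
under eq_bigr => f _ do rewrite mulr_sumr mulr_sumr.
rewrite exchange_big /= (bigD1 a) //= [X in _ + X]big1 ?addr0 => [|b ba]; last first.
  under eq_bigr => f _ do rewrite gE.
  rewrite sum_prod_weights_fun (bigD1 b) //= [X in X * _](_ : _ = 0) ?mul0r //.
  rewrite -[RHS]h0; apply: eq_bigr => j _.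
  by rewrite /g eqxx (negbTE ba) mul1r.
under eq_bigr => f _ do rewrite gE.
rewrite sum_prod_weights_fun (bigD1 a) //= [X in _ * X]big1 ?mulr1 => [|i ia].
  rewrite -[leRHS]mul1r -mu1 mulr_suml; apply: ler_sum => j _.
  by rewrite /g eqxx -expr2 ler_wpM2l.
rewrite -[RHS]mu1; apply: eq_bigr => j _.
by rewrite /g (negbTE ia) !mulr1.
Qed.

Lemma chebyshev_copies (R : realFieldType) (I J : finType) (mu h : J -> R) (v d : R) :
  (forall j, 0 <= mu j) -> \sum_j mu j = 1 -> \sum_j mu j * h j = 0 ->
  (forall j, h j ^+ 2 <= v) -> 0 < d ->
  \sum_(f : {ffun I -> J} | d <= `|\sum_i h (f i)|) \prod_i mu (f i)
    <= #|I|%:R * v / d ^+ 2.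
Proof.
move=> mu0 mu1 h0 hv d0; rewrite ler_pdivlMr ?exprn_gt0 //.
have := second_moment_copies I mu0 mu1 h0 hv; apply: le_trans.
rewrite mulr_suml big_mkcond; apply: ler_sum => f _.
have mu_f : 0 <= \prod_i mu (f i) by apply: prodr_ge0.
case: ifP => [df|_]; last by rewrite mulr_ge0 ?sqr_ge0.
by rewrite ler_wpM2l // -[leRHS]real_normK ?num_real // ler_pXn2r ?nnegrE // ltW.
Qed.

(** Newman's theorem.  If the [om j] are drawn independently from [mu], the
    potential [\sum_b 8 ^+ #{j | bad b (om j)}] has expectation at most
    [#|B| * (3/2) ^+ #|J|], whereas a [b] that is bad for more than a third of
    the [j] contributes more than [2 ^+ #|J|] on its own. *)
Lemma newman (R : realFieldType) (B J Om : finType) (mu : Om -> R)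
    (bad : B -> Om -> bool) :
  (forall x, 0 <= mu x) -> \sum_x mu x = 1 ->
  (forall b, \sum_(x | bad b x) mu x <= 1 / 14) ->
  (#|B|%:R * 3 ^+ #|J| < 4 ^+ #|J| :> R) ->
  exists om : J -> Om, forall b, (#|[pred j | bad b (om j)]| * 3 <= #|J|)%N.
Proof.
move=> mu0 mu1 bad_le card_lt.
pose pot (f : {ffun J -> Om}) : R :=
  \sum_b \prod_j (if bad b (f j) then 8 else 1).
have pot_le : \sum_(f : {ffun J -> Om}) (\prod_j mu (f j)) * pot f
    <= #|B|%:R * (3 / 2) ^+ #|J|.
  under eq_bigr => f _ do rewrite mulr_sumr.
  rewrite exchange_big mulr_natl -sumr_const; apply: ler_sum => b _.
  rewrite (sum_prod_weights_fun mu (fun _ x => if bad b x then 8 else 1)).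
  rewrite prodr_const lerXn2r ?nnegrE //; last first.
    (* The value 8 and the bound 1/14 give the mean [1 + 7 / 14 = 3 / 2] per coordinate. *)
    have -> : \sum_x mu x * (if bad b x then 8 else 1) =
        \sum_x mu x + 7 * \sum_(x | bad b x) mu x.
      rewrite [X in 7 * X]big_mkcond mulr_sumr -big_split; apply: eq_bigr => x _ /=.
      by case: ifP => _; ring.
    by rewrite mu1; have := bad_le b; lra.
  by apply: sumr_ge0 => x _; rewrite mulr_ge0 //; case: ifP.
have [f pot_f] : exists f, pot f < 2 ^+ #|J|.
  apply/existsP; apply: contraT; rewrite negb_exists => /forallP pot_ge.
  have : 2 ^+ #|J| <= \sum_(f : {ffun J -> Om}) (\prod_j mu (f j)) * pot f.
    rewrite -[leLHS]mul1r -[X in X * _ <= _](sum_prod_weights J mu1) mulr_suml; apply: ler_sum => f _.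
    by rewrite ler_wpM2l ?prodr_ge0 // leNgt.
  move/le_trans/(_ pot_le); rewrite exprMn exprVn mulrA ler_pdivlMr ?exprn_gt0 //.
  by rewrite -exprMn leNgt (_ : 2 * 2 = 4) ?card_lt //; lra.
exists f => b; rewrite leqNgt; apply/negP => many.
move: pot_f; rewrite ltNge => /negP[].
have pot_ge : \prod_j (if bad b (f j) then 8 else 1) <= pot f.
  rewrite /pot (bigD1 b) //= lerDl; apply: sumr_ge0 => b' _.
  by apply: prodr_ge0 => j _; case: ifP.
apply: le_trans pot_ge; rewrite -big_mkcond prodr_const.
have -> : (8 : R) = 2 ^+ 3 by rewrite !exprS; lra.
rewrite -exprM ler_eXn2l ?ltr1n // mulnC; apply: ltnW.
by apply: leq_trans many _.
Qed.

(** * Linear sketches *)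

Lemma card_embedding (A B : finType) :
  (#|A| <= #|B|)%N -> exists enc : A -> B, injective enc.
Proof.
move=> le_AB; exists (fun a => enum_val (widen_ord le_AB (enum_rank a))).
move=> a b /enum_val_inj /(congr1 val) /= ab; apply: enum_rank_inj.
exact: val_inj.
Qed.

(** Sums in a group compose by addition, so any such sum is a sketch as soon as the group fits into
    [s] bits. *)
Lemma linear_sketching_algorithm (k n s t : nat) (G : finZmodType)
    (h : t.-tuple bool -> constraint k n -> G) (ans : t.-tuple bool -> G -> bool) :
  (#|G| <= 2 ^ s)%N ->
  exists A : sketching_algorithm k n, alg_space A = (t + s)%N /\
    forall (R : realType) (Psi : seq (constraint k n)) (b : bool),
      prob_output R A Psi b =
        #|[pred r | ans r (\sum_(c <- Psi) h r c) == b]|%:R / 2 ^+ t.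
Proof.
rewrite -[X in (X ^ _)%N]card_bool -(card_tuple s bool) => /card_embedding[enc enc_inj].
(* The default 0 is never met in a run: every reachable state lies in the image of [enc]. *)
pose dec x := odflt 0 [pick g | enc g == x].
have encK : cancel enc dec.
  move=> g; rewrite /dec; case: pickP => [g' /eqP /enc_inj //|/(_ g)].
  by rewrite eqxx.
pose step r x c := enc (dec x + h r c).
have runE r x Psi : run (enc x) (step r) Psi = enc (x + \sum_(c <- Psi) h r c).
  elim: Psi x => [|c Psi IH] x /=; first by rewrite big_nil addr0.
  by rewrite /run /= -/(run _ _ _) {1}/step encK IH big_cons addrA.
have comb r Psi Phi : run (enc 0) (step r) (Psi ++ Phi) =
    enc (dec (run (enc 0) (step r) Psi) + dec (run (enc 0) (step r) Phi)).
  by rewrite !runE !encK !add0r big_cat.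
exists (@SketchingAlgorithm k n t s (fun=> enc 0) step (fun r x => ans r (dec x))
  (fun _ x y => enc (dec x + dec y)) comb).
split=> // R Psi b; rewrite /prob_output /=; congr (_%:R / _).
by apply: eq_card => r; rewrite !inE /alg_output /= runE encK add0r.
Qed.

(** * Biases and rounding *)

(** The coordinates outside the image of [idx] sum to 1, and injectivity keeps the selected ones
    independent. This restricts a random assignment to the variables of one constraint, and later
    discards padding variables. *)
Lemma sum_marginal (R : comPzRingType) (I J : finType) (p : J -> bool -> R)
    (idx : I -> J) (G : {ffun I -> bool} -> R) :
  injective idx -> (forall j, \sum_b p j b = 1) ->
  \sum_(a : {ffun J -> bool}) (\prod_j p j (a j)) * G [ffun i => a (idx i)] =
  \sum_(y : {ffun I -> bool}) (\prod_i p (idx i) (y i)) * G y.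
Proof.
move=> idx_inj p1.
rewrite (partition_big (fun a : {ffun J -> bool} => [ffun i => a (idx i)]) xpredT) //=.
apply: eq_bigr => y _.
rewrite (eq_bigr (fun a : {ffun J -> bool} => (\prod_j p j (a j)) * G y)); last first.
  by move=> a /eqP ->.
rewrite -mulr_suml; congr (_ * _); rewrite big_mkcond /=.
(* The condition that [a] restricts to [y] is moved into the weights, so that the sum over [a]
   factors. *)
pose F j b := if [forall i, (idx i == j) ==> (y i == b)] then p j b else 0.
rewrite (eq_bigr (fun a : {ffun J -> bool} => \prod_j F j (a j))); last first.
  move=> a _; case: eqP => [ay|a_neq].
    apply: eq_bigr => j _; rewrite /F; case: forallP => // -[] i.
    by apply/implyP => /eqP <-; rewrite -ay ffunE.
  have [i yi] : exists i, y i != a (idx i).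
    apply/existsP; apply: contra_notT a_neq; rewrite negb_exists => /forallP ay.
    by apply/ffunP => i; rewrite ffunE; have /negPn/eqP := ay i.
  rewrite (bigD1 (idx i)) //= /F; case: forallP => [/(_ i)|]; last by rewrite mul0r.
  by rewrite eqxx (negbTE yi).
rewrite -bigA_distr_bigA [RHS](partition_big idx xpredT) //=.
apply: eq_bigr => j _; have [i /eqP ij|no_i] := pickP (fun i => idx i == j).
  rewrite (bigD1 (y i)) //= big1 => [|b b_neq].
    rewrite addr0 /F; case: forallP => [_|[] i']; last first.
      by apply/implyP; rewrite -ij => /eqP /idx_inj ->.
    by rewrite (big_pred1 i) ?ij // => i' /=; rewrite -ij (inj_eq idx_inj).
  rewrite /F; case: forallP => // /(_ i).
  by rewrite ij eqxx eq_sym (negbTE b_neq).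
rewrite [RHS]big_pred0 // -[RHS](p1 j); apply: eq_bigr => b _.
by rewrite /F; case: forallP => // -[] i; rewrite no_i.
Qed.

Definition noise (R : realType) (a b : bool) : R := if a == b then 2 / 3 else 1 / 3.

Lemma noise_ge0 (R : realType) (a b : bool) : 0 <= noise R a b.
Proof. by rewrite /noise; case: ifP => _; lra. Qed.

Lemma sum_noise (R : realType) (a : bool) : \sum_b noise R a b = 1.
Proof. by rewrite big_bool /noise; case: a => /=; lra. Qed.

Lemma noise_addb (R : realType) (a b s : bool) :
  noise R (a (+) s) (b (+) s) = noise R a b.
Proof. by case: a b s => [] [] []. Qed.

(** The noise operator of correlation 1/3 applied to [f]. *)
Definition noisy (R : realType) (k : nat) (f : cube k -> bool) (x : cube k) : R :=
  \sum_(y : cube k) (\prod_i noise R (x i) (y i)) * (f y)%:R.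

(** The last clause bounds from below the probability that [f] holds after each
    coordinate of [x] is flipped independently with probability 1/3. The gap
    between 4/3 and 2 is what the streaming algorithm detects. *)
Definition certificate (R : realType) (k : nat) (f : cube k -> bool)
    (lam : 'I_k -> int) : Prop :=
  [/\ (\sum_i `|lam i| <= 12)%N,
    forall x, f x -> 2 <= linear_form (fun i => (lam i)%:~R : R) x &
    forall x, linear_form (fun i => (lam i)%:~R : R) x - 4 / 3
      <= 18 * (2 * noisy R f x - 1)].

Definition bias (k n : nat) (lam : 'I_k -> int) (Psi : seq (constraint k n))
    (j : 'I_n) : int :=
  \sum_(c <- Psi) \sum_(i < k | (val c i).1 == j)
    (if (val c i).2 then - lam i else lam i).

Definition literals (k n : nat) (a : cube n) (c : constraint k n) : cube k :=
  [ffun i => literal_value a (val c i)].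

Lemma literal_valueE (n : nat) (a : cube n) (l : literal n) :
  literal_value a l = a l.1 (+) l.2.
Proof. by rewrite /literal_value; case: l.2; rewrite ?addbT ?addbF. Qed.

(** Each occurrence of a literal contributes [lam i] times its value; grouping by variables or by
    constraints gives the two sides. *)
Lemma bias_pm1 (R : realType) (k n : nat) (lam : 'I_k -> int)
    (Psi : seq (constraint k n)) (a : cube n) :
  \sum_j (bias lam Psi j)%:~R * pm1 R (a j) =
  \sum_(c <- Psi) linear_form (fun i => (lam i)%:~R) (literals a c).
Proof.
under eq_bigr => j _ do rewrite rmorph_sum mulr_suml.
rewrite exchange_big; apply: eq_bigr => c _.
rewrite /linear_form [RHS](partition_big (fun i => (val c i).1) xpredT) //=.
apply: eq_bigr => j _; rewrite rmorph_sum mulr_suml; apply: eq_bigr => i /eqP <-.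
rewrite ffunE literal_valueE /pm1.
by case: (val c i).2; case: (a _); rewrite /= ?rmorphN /=; ring.
Qed.

Lemma bias_norm (k n : nat) (lam : 'I_k -> int) (Psi : seq (constraint k n)) :
  (\sum_j `|bias lam Psi j| <= (\sum_i `|lam i|) * size Psi)%N.
Proof.
have PoszE (I : finType) (F : I -> int) : Posz (\sum_i `|F i|)%N = \sum_i `|F i|.
  by rewrite (big_morph Posz PoszD (erefl _)); apply: eq_bigr => i _; rewrite abszE.
rewrite -lez_nat PoszM !PoszE.
have le_c (c : constraint k n) : \sum_j `|\sum_(i < k | (val c i).1 == j)
    (if (val c i).2 then - lam i else lam i)| <= \sum_i `|lam i|.
  rewrite [leRHS](partition_big (fun i => (val c i).1) xpredT) //=.
  apply: ler_sum => j _; apply: le_trans (ler_norm_sum _ _ _) _.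
  by apply: ler_sum => i _; case: ifP; rewrite ?normrN.
apply: (@le_trans _ _ (\sum_(c <- Psi) \sum_i `|lam i|)); last first.
  by rewrite big_const_seq count_predT iter_addr_0 -mulr_natr natz.
apply: le_trans (ler_sum _ (fun c _ => le_c c)).
by rewrite exchange_big; apply: ler_sum => j _; exact: ler_norm_sum.
Qed.

Definition negc (k : nat) (x : cube k) : cube k := [ffun i => ~~ x i].

Lemma negcK (k : nat) : involutive (@negc k).
Proof. by move=> x; apply/ffunP => i; rewrite !ffunE negbK. Qed.

Lemma balancedLTF_negc (R : realType) (k : nat) (f : cube k -> bool) (x : cube k) :
  balancedLTF R f -> f (negc x) = ~~ f x.
Proof.
case=> w [fE w0]; rewrite !fE !addr0 /sign01.
have -> : linear_form w (negc x) = - linear_form w x.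
  rewrite /linear_form -sumrN; apply: eq_bigr => i _.
  by rewrite ffunE /pm1; case: (x i) => /=; ring.
by rewrite oppr_gt0 lt_neqAle -leNgt; have /eqP -> := w0 x.
Qed.

(** The antipodal map exchanges the points where [f] holds with those where it fails. *)
Lemma rho_balancedLTF (R : realType) (k : nat) (f : cube k -> bool) :
  balancedLTF R f -> rho R f = 1 / 2.
Proof.
move=> hf; rewrite /rho; set A := [pred x | f x].
have cardA : #|A| = #|[predC A]|.
  rewrite -(fintype.card_image (can_inj (@negcK k)) A); apply: fintype.eq_card => x.
  apply/fintype.imageP/idP => [[y yA ->]|xA].
    by rewrite !inE (balancedLTF_negc _ hf) negbK; move: yA; rewrite inE.
  by exists (negc x); rewrite ?negcK // !inE (balancedLTF_negc _ hf).
have := cardC A; rewrite -cardA card_ffun card_bool card_ord => /(congr1 (GRing.natmul (1 : R))).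
have half (x : R) : x + x != 0 -> x / (x + x) = 1 / 2.
  by rewrite -mulr2n mulrn_eq0 /= => x0; field.
rewrite natrD natrX => <-; apply: half.
by rewrite -natrD {2}cardA cardC card_ffun card_bool card_ord pnatr_eq0 -lt0n expn_gt0.
Qed.

Lemma linear_form_ge (R : realType) (k : nat) (lam : 'I_k -> int) (x : cube k) :
  (\sum_i `|lam i| <= 12)%N -> -12 <= linear_form (fun i => (lam i)%:~R : R) x.
Proof.
move=> lam12; have : - (\sum_i `|lam i|)%N%:R <= linear_form (fun i => (lam i)%:~R : R) x.
  rewrite raddf_sum -sumrN; apply: ler_sum => i _ /=.
  rewrite natr_absz intr_norm /pm1; case: (x i); rewrite ?mulr1 ?mulrN1 ?lerN2.
    by rewrite lerNl ler_normr lexx orbT.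
  by rewrite ler_norm.
by apply: le_trans; rewrite lerN2 ler_nat.
Qed.

(** At an optimal assignment the l1 norm dominates the sum of the linear forms, which are at least 2
    on satisfied constraints and at least -12 on the others;
    [14 * (1 - eps) - 12 = 2 - 14 * eps]. *)
Lemma bias_high_val (R : realType) (k n : nat) (f : cube k -> bool)
    (lam : 'I_k -> int) (Psi : seq (constraint k n)) (eps : R) :
  certificate R f lam -> (0 < size Psi)%N -> 1 - eps <= csp_val R f Psi ->
  (2 - 14 * eps) * (size Psi)%:R <= (\sum_j `|bias lam Psi j|)%N%:R.
Proof.
case=> lam12 lam_sat _ m0 val_ge; have m0' : 0 < (size Psi)%:R :> R by rewrite ltr0n.
have card0 : (0 < #|{: cube n}|)%N.
  by rewrite card_ffun card_bool card_ord expn_gt0.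
have [a maxE] := bigop.eq_bigmax (fun a : cube n => count (satisfied f a) Psi) card0.
move: val_ge; rewrite /csp_val maxE ler_pdivlMr // => sat_ge.
have : \sum_j (bias lam Psi j)%:~R * pm1 R (a j) <= (\sum_j `|bias lam Psi j|)%N%:R.
  rewrite raddf_sum; apply: ler_sum => j _ /=; rewrite natr_absz intr_norm /pm1.
  by case: (a j); rewrite ?mulr1 ?mulrN1 ?ler_norm // ler_normr lexx orbT.
apply: le_trans; rewrite bias_pm1.
have : 14 * (count (satisfied f a) Psi)%:R - 12 * (size Psi)%:R <=
    \sum_(c <- Psi) linear_form (fun i => (lam i)%:~R : R) (literals a c).
  rewrite -sum1_count big_mkcond -sum1_size !natr_sum !mulr_sumr -sumrB.
  apply: ler_sum => c _; rewrite /satisfied -/(literals a c).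
  have := linear_form_ge R (literals a c) lam12; case: ifP => [/lam_sat|_]; lra.
by apply: le_trans; lra.
Qed.

(** Give each variable the sign of its bias, so that the linear forms sum to the l1 norm, then flip
    it with probability 1/3. The expected number of satisfied constraints is at most the maximum,
    and the last clause of [certificate] turns this into a bound on the l1 norm. *)
Lemma bias_low_val (R : realType) (k n : nat) (f : cube k -> bool)
    (lam : 'I_k -> int) (Psi : seq (constraint k n)) (eps : R) :
  certificate R f lam -> (0 < size Psi)%N -> csp_val R f Psi < 1 / 2 + eps ->
  (\sum_j `|bias lam Psi j|)%N%:R <= (4 / 3 + 36 * eps) * (size Psi)%:R.
Proof.
case=> _ _ lam_noisy m0; have m0' : 0 < (size Psi)%:R :> R by rewrite ltr0n.
pose M := (\max_(a : cube n) count (satisfied f a) Psi)%N; rewrite /csp_val -/M ltr_pdivrMr // => val_lt.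
pose a : cube n := [ffun j => 0 <= bias lam Psi j].
have -> : (\sum_j `|bias lam Psi j|)%N%:R =
    \sum_(c <- Psi) linear_form (fun i => (lam i)%:~R : R) (literals a c).
  rewrite -bias_pm1 raddf_sum; apply: eq_bigr => j _ /=.
  rewrite ffunE natr_absz intr_norm /pm1; case: leP => B0.
    by rewrite mulr1 ger0_norm // ler0z.
  by rewrite mulrN1 ltr0_norm // ltrz0.
have mean_le : \sum_(b : cube n) (\prod_j noise R (a j) (b j)) *
    (count (satisfied f b) Psi)%:R <= M%:R.
  have : \sum_(b : cube n) (\prod_j noise R (a j) (b j)) * M%:R <= M%:R.
    by rewrite -mulr_suml -(bigA_distr_bigA (fun j => noise R (a j))) big1 ?mul1r //
      => j _; exact: sum_noise.
  apply: le_trans; apply: ler_sum => b _; apply: ler_wpM2l.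
    by apply: prodr_ge0 => j _; exact: noise_ge0.
  by rewrite ler_nat; exact: (leq_bigmax (F := fun a : cube n => count (satisfied f a) Psi)).
(* By linearity each constraint is treated alone; its variables are distinct, and the noise commutes
   with negating literals. *)
have meanE : \sum_(b : cube n) (\prod_j noise R (a j) (b j)) *
    (count (satisfied f b) Psi)%:R = \sum_(c <- Psi) noisy R f (literals a c).
  under eq_bigr => b _ do rewrite -sum1_count [X in X%:R]big_mkcond natr_sum mulr_sumr.
  rewrite [LHS]exchange_big; apply: eq_bigr => c _.
  pose s i := (val c i).2.
  pose G (y : cube k) : R := (f [ffun i => y i (+) s i])%:R.
  rewrite (eq_bigr (fun b : cube n => (\prod_j noise R (a j) (b j)) *
      G [ffun i => b (val c i).1])); last first.
    move=> b _; congr (_ * _); rewrite /G /satisfied.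
    have -> : [ffun i => literal_value b (val c i)] =
        [ffun i => [ffun i => b (val c i).1] i (+) s i].
      by apply/ffunP => i; rewrite !ffunE literal_valueE.
    by case: (f _).
  rewrite (sum_marginal G (p := fun j => noise R (a j)) (idx := fun i => (val c i).1)).
  - pose flip (y : cube k) : cube k := [ffun i => y i (+) s i].
    have flipK : involutive flip by move=> y; apply/ffunP => i; rewrite !ffunE addbK.
    rewrite /noisy [RHS](reindex_inj (can_inj flipK)); apply: eq_bigr => y _.
    congr (_ * _); apply: eq_bigr => i _.
    by rewrite [flip y i]ffunE [literals a c i]ffunE literal_valueE noise_addb.
  - exact/injectiveP/(valP c).
  - by move=> j; exact: sum_noise.
have : \sum_(c <- Psi) linear_form (fun i => (lam i)%:~R : R) (literals a c) <=
    36 * \sum_(c <- Psi) noisy R f (literals a c) + (4 / 3 - 18) * (size Psi)%:R.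
  rewrite -sum1_size natr_sum !mulr_sumr -big_split; apply: ler_sum => c _ /=.
  by have := lam_noisy (literals a c); lra.
move: mean_le; rewrite meanE; lra.
Qed.

(** * Balanced LTFs on at most four variables *)

(** Quadruples of booleans stand for points of the cube, so that the finite checks run by
    computation. *)
Definition pick4 (x : cube 4) := (x (inord 0), x (inord 1), x (inord 2), x (inord 3)).

Definition cube4 (b : bool * bool * bool * bool) : cube 4 :=
  [ffun i : 'I_4 => nth false [:: b.1.1.1; b.1.1.2; b.1.2; b.2] i].

Lemma cube4K : cancel cube4 pick4.
Proof. by case=> [[[b0 b1] b2] b3]; rewrite /pick4 !ffunE !inordK. Qed.

Lemma pick4K : cancel pick4 cube4.
Proof.
move=> y; apply/ffunP => i; rewrite ffunE -[in RHS](inord_val i).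
by case: i => [[|[|[|[|]]]]].
Qed.

Definition dot4 (l : seq int) (x : bool * bool * bool * bool) : int :=
  let s (b : bool) (z : int) := if b then z else - z in
  s x.1.1.1 l`_0 + s x.1.1.2 l`_1 + s x.1.2 l`_2 + s x.2 l`_3.

Definition bools4 : seq (bool * bool * bool * bool) :=
  let B := [:: true; false] in
  [seq (p, b) | p <- [seq (p, b) | p <- [seq (p, b) | p <- B, b <- B], b <- B], b <- B].

Lemma mem_bools4 x : x \in bools4.
Proof. by move: x => [[[[] []] []] []]. Qed.

(** The product of the four [noise] factors, times [3 ^ 4]. *)
Definition agree4 (x y : bool * bool * bool * bool) : nat :=
  let s (a b : bool) := if a == b then 2%N else 1%N in
  (s x.1.1.1 y.1.1.1 * s x.1.1.2 y.1.1.2 * s x.1.2 y.1.2 * s x.2 y.2)%N.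

(** [81 * noisy]; the bound in [check4] is the last clause of [certificate] after
    clearing denominators. *)
Definition score4 (l : seq int) (x : bool * bool * bool * bool) : nat :=
  sumn [seq (if 0 < dot4 l y then agree4 x y else 0%N) | y <- bools4].

Definition check4 (l : seq int) : bool :=
  (`|(l`_0)%R| + `|(l`_1)%R| + `|(l`_2)%R| + `|(l`_3)%R| <= 12)%N &&
  all (fun x => ((0 < dot4 l x) ==> (2 <= dot4 l x)) &&
                (9 * dot4 l x + 150 <= (4 * score4 l x)%N%:Z)) bools4.

Lemma linear_form_cube4 (R : realType) (w : 'I_4 -> R) b :
  linear_form w (cube4 b) =
    w (inord 0) * pm1 R b.1.1.1 + w (inord 1) * pm1 R b.1.1.2 +
    w (inord 2) * pm1 R b.1.2 + w (inord 3) * pm1 R b.2.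
Proof.
have E (G : 'I_4 -> R) :
    \sum_i G i = G (inord 0) + G (inord 1) + G (inord 2) + G (inord 3).
  rewrite !big_ord_recl big_ord0 addr0 !addrA.
  by congr (G _ + G _ + G _ + G _); apply: val_inj; rewrite /= inordK.
by rewrite /linear_form E !ffunE !inordK.
Qed.

Lemma linear_form_dot4 (R : realType) (l : seq int) b :
  linear_form (fun i : 'I_4 => (l`_i)%:~R : R) (cube4 b) = (dot4 l b)%:~R.
Proof.
rewrite linear_form_cube4 !inordK // /dot4 /pm1.
by case: b => [[[[] []] []] []] /=; rewrite !rmorphD /= ?rmorphN /=; ring.
Qed.

Lemma check4_certificate (R : realType) (l : seq int) :
  check4 l ->
  certificate R (fun x : cube 4 => 0 < dot4 l (pick4 x)) (fun i : 'I_4 => l`_i).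
Proof.
case/andP => sum_l /allP check_l.
have linE x : linear_form (fun i : 'I_4 => (l`_i)%:~R : R) x = (dot4 l (pick4 x))%:~R.
  by rewrite -linear_form_dot4 pick4K.
split => [|x x_pos|x].
- by rewrite !big_ord_recl big_ord0 addn0 /= !addnA.
- have /andP[/implyP/(_ x_pos) x2 _] := check_l _ (mem_bools4 (pick4 x)).
  by rewrite linE (ler_int R 2).
have /andP[_ x_le] := check_l _ (mem_bools4 (pick4 x)).
rewrite linE; move: (pick4 x) (pick4K x) x_le => b <- {x linE}.
rewrite -(ler_int R) rmorphD rmorphM /= -[leRHS]pmulrn natrM.
have -> : noisy R (fun x : cube 4 => 0 < dot4 l (pick4 x)) (cube4 b) =
    (score4 l b)%:R / 81.
  rewrite /noisy (reindex cube4); last by exists pick4 => y _; rewrite ?cube4K ?pick4K.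
  rewrite -big_enum (perm_big bools4) /=; last first.
    rewrite uniq_perm ?enum_uniq // => y; by rewrite mem_enum mem_bools4.
  rewrite /score4 sumnE big_map natr_sum mulr_suml; apply: eq_bigr => y _.
  rewrite cube4K !big_ord_recl big_ord0 !ffunE /= /noise /agree4.
  case: (0 < _); last by rewrite mulr0 mul0r.
  by do 4! case: (_ == _) => /=; lra.
lra.
Qed.

Lemma dot4N (l : seq int) b0 b1 b2 b3 :
  dot4 l (~~ b0, ~~ b1, ~~ b2, ~~ b3) = - dot4 l (b0, b1, b2, b3).
Proof. by case: b0 b1 b2 b3 => [] [] [] []; rewrite /dot4 /=; ring. Qed.

(** Up to signs and order the balanced LTFs are the dictator, the majority of
    three and the monarchy, with weights [l] proportional to (1,0,0,0), (1,1,1,0)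
    and (2,1,1,1), scaled so that a single inequality [check4] fits all three. *)
Lemma classify4 (R : realFieldType) (a0 a1 a2 a3 : R) :
  let E (b0 b1 b2 b3 : bool) := (if b0 then a0 else - a0) + (if b1 then a1 else - a1)
    + (if b2 then a2 else - a2) + (if b3 then a3 else - a3) in
  0 <= a0 -> 0 <= a1 -> 0 <= a2 -> 0 <= a3 -> (forall b0 b1 b2 b3, E b0 b1 b2 b3 <> 0) ->
  exists l : seq int, [/\ check4 l,
    forall b0 b1 b2 b3, (0 < E b0 b1 b2 b3) = (0 < dot4 l (b0, b1, b2, b3)) &
    [/\ a0 = 0 -> l`_0 = 0, a1 = 0 -> l`_1 = 0, a2 = 0 -> l`_2 = 0 & a3 = 0 -> l`_3 = 0]].
Proof.
move=> E a0_ge0 a1_ge0 a2_ge0 a3_ge0 nz.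
have EN b0 b1 b2 b3 : E (~~ b0) (~~ b1) (~~ b2) (~~ b3) = - E b0 b1 b2 b3.
  by rewrite /E; case: b0 b1 b2 b3 => [] [] [] [] /=; ring.
(* Both forms are odd and nonzero, so comparing signs on the points with first bit [true]
   suffices. *)
have conclude (l : seq int) : check4 l ->
    (forall b1 b2 b3, dot4 l (true, b1, b2, b3) != 0) ->
    (forall b1 b2 b3, (0 < E true b1 b2 b3) = (0 < dot4 l (true, b1, b2, b3))) ->
    [/\ a0 = 0 -> l`_0 = 0, a1 = 0 -> l`_1 = 0, a2 = 0 -> l`_2 = 0 & a3 = 0 -> l`_3 = 0] ->
    exists l : seq int, [/\ check4 l,
      forall b0 b1 b2 b3, (0 < E b0 b1 b2 b3) = (0 < dot4 l (b0, b1, b2, b3)) &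
      [/\ a0 = 0 -> l`_0 = 0, a1 = 0 -> l`_1 = 0, a2 = 0 -> l`_2 = 0 & a3 = 0 -> l`_3 = 0]].
  move=> check_l dot_nz pos l0; exists l; split=> // -[] // b1 b2 b3.
  have := EN true (~~ b1) (~~ b2) (~~ b3); rewrite !negbK => ->.
  have := dot4N l true (~~ b1) (~~ b2) (~~ b3); rewrite !negbK => ->.
  rewrite !oppr_gt0 !lt_neqAle !leNgt pos dot_nz.
  by have /eqP -> := nz true (~~ b1) (~~ b2) (~~ b3).
have sgn b1 b2 b3 : (0 < E true b1 b2 b3) /\ (0 < E true b1 b2 b3) = true \/
    (E true b1 b2 b3 < 0) /\ (0 < E true b1 b2 b3) = false.
  have /eqP := nz true b1 b2 b3; rewrite neq_lt => /orP[neg|pos]; last by left; rewrite pos.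
  by right; split=> //; apply/negbTE; rewrite -leNgt ltW.
have E0 : (0 < E true true true true) = true.
  by have [[]//|[]] := sgn true true true; rewrite /E; lra.
have := sgn false false false; have := sgn false true true; have := sgn true false true.
have := sgn true true false; have := sgn true false false.
have := sgn false true false; have := sgn false false true.
rewrite /E in E0 conclude *; clear sgn nz EN E.
(* [D0] gives the sign of [a0] minus the other three weights; for [i] in 1, 2, 3, [Di] gives that of
   the other three minus [ai], and [Si] that of the pair 0, [i] minus the complementary pair. A
   dominating weight is a dictator. *)
move=> S3 S2 S1 D3 D2 D1 D0.
have pos (x : R) : 0 < x -> (0 < x) = true by [].
have neg (x : R) : x < 0 -> (0 < x) = false.
  by move=> x0; apply/negbTE; rewrite -leNgt ltW.
case: D0 => -[D0 F0].
  clear S1 S2 S3 D1 D2 D3; apply: (conclude [:: 6; 0; 0; 0]) => //.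
  - by move=> [] [] [].
  - clear conclude; move=> [] [] []; rewrite pos //; lra.
  - by clear conclude; split=> //= ?; exfalso; lra.
case: D1 => -[D1 F1]; last first.
  clear S1 S2 S3 D0 F0 D2 D3; apply: (conclude [:: 0; 6; 0; 0]) => //.
  - by move=> [] [] [].
  - clear conclude; move=> [] [] []; first [rewrite pos //; lra | rewrite neg //; lra].
  - by clear conclude; split=> //= ?; exfalso; lra.
case: D2 => -[D2 F2]; last first.
  clear S1 S2 S3 D0 F0 D1 F1 D3; apply: (conclude [:: 0; 0; 6; 0]) => //.
  - by move=> [] [] [].
  - clear conclude; move=> [] [] []; first [rewrite pos //; lra | rewrite neg //; lra].
  - by clear conclude; split=> //= ?; exfalso; lra.
case: D3 => -[D3 F3]; last first.
  clear S1 S2 S3 D0 F0 D1 F1 D2 F2; apply: (conclude [:: 0; 0; 0; 6]) => //.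
  - by move=> [] [] [].
  - clear conclude; move=> [] [] []; first [rewrite pos //; lra | rewrite neg //; lra].
  - by clear conclude; split=> //= ?; exfalso; lra.
(* With no dictator, the winning pairs decide: three pairs through one point give a monarchy, three
   pairs inside a triple give a majority. *)
pose L (s1 s2 s3 : bool) : seq int :=
  match s1, s2, s3 with
  | true, true, true => [:: 4; 2; 2; 2]
  | true, false, false => [:: 2; 4; 2; 2]
  | false, true, false => [:: 2; 2; 4; 2]
  | false, false, true => [:: 2; 2; 2; 4]
  | false, false, false => [:: 0; 3; 3; 3]
  | false, true, true => [:: 3; 0; 3; 3]
  | true, false, true => [:: 3; 3; 0; 3]
  | true, true, false => [:: 3; 3; 3; 0]
  end.
case: S1 => -[S1 G1]; case: S2 => -[S2 G2]; case: S3 => -[S3 G3];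
  [ apply: (conclude (L true true true)) | apply: (conclude (L true true false))
  | apply: (conclude (L true false true)) | apply: (conclude (L true false false))
  | apply: (conclude (L false true true)) | apply: (conclude (L false true false))
  | apply: (conclude (L false false true)) | apply: (conclude (L false false false))];
  rewrite // /L.
all: try by move=> [] [] []; rewrite ?(E0, F0, F1, F2, F3, G1, G2, G3).
all: clear conclude pos neg L E0 F0 F1 F2 F3 G1 G2 G3.
(* Each coordinate with a nonzero entry of [l] influences the sign somewhere, which a zero weight
   cannot do. *)
all: by split=> //= ?; exfalso; lra.
Qed.

Lemma certificate_nonneg4 (R : realType) (a : 'I_4 -> R) :
  (forall i, 0 <= a i) -> (forall x : cube 4, linear_form a x <> 0) ->
  exists lam : 'I_4 -> int,
    certificate R (fun x : cube 4 => 0 < linear_form a x) lam /\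
    forall i, a i = 0 -> lam i = 0.
Proof.
move=> a_ge0 a_nz.
have nz b0 b1 b2 b3 := a_nz (cube4 (b0, b1, b2, b3)).
have pmE (x : R) b : (if b then x else - x) = x * pm1 R b.
  by case: b; rewrite /pm1 ?mulr1 ?mulrN1.
have [|l [check_l l_pos [l0 l1 l2 l3]]] := classify4 (a_ge0 (inord 0)) (a_ge0 (inord 1))
    (a_ge0 (inord 2)) (a_ge0 (inord 3)).
  by move=> b0 b1 b2 b3; have := nz b0 b1 b2 b3; rewrite linear_form_cube4 !pmE.
exists (fun i => l`_i); split; last first.
  move=> i; rewrite -(inord_val i).
  by case: i => [[|[|[|[|]]]]] // ? /=; rewrite inordK.
rewrite (_ : (fun x => _) = fun x : cube 4 => 0 < dot4 l (pick4 x)).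
  exact: check4_certificate.
apply/funext => x; rewrite -{1}(pick4K x).
by case: (pick4 x) => [[[b0 b1] b2] b3]; rewrite linear_form_cube4 -l_pos !pmE.
Qed.

Lemma sum_widen_ord (R : nmodType) (k n : nat) (kn : (k <= n)%N) (F : 'I_n -> R) :
  (forall j : 'I_n, (k <= j)%N -> F j = 0) -> \sum_j F j = \sum_i F (widen_ord kn i).
Proof.
move=> F0; rewrite -(big_ord_narrow kn) [RHS]big_mkcond; apply: eq_bigr => j _.
by case: ltnP => // /F0.
Qed.

(** Flipping coordinates makes the weights nonnegative and zero weights pad them to four; the
    certificate for four variables is pulled back. It vanishes on the padding, so no contribution is
    lost. *)
Lemma exists_certificate (R : realType) (k : nat) (f : cube k -> bool) :
  (k <= 4)%N -> balancedLTF R f -> exists lam, certificate R f lam.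
Proof.
move=> k4 [w [fE w_nz]].
pose neg i := w i < 0.
pose a (j : 'I_4) : R := if insub (val j) is Some i then `|w i| else 0.
have a_widen i : a (widen_ord k4 i) = `|w i| by rewrite /a /= valK.
have a_out (j : 'I_4) : (k <= j)%N -> a j = 0.
  by move=> kj; rewrite /a insubF // ltnNge kj.
pose restr (y : cube 4) : cube k := [ffun i => y (widen_ord k4 i)].
pose flip (y : cube k) : cube k := [ffun i => y i (+) neg i].
have flipK : involutive flip by move=> y; apply/ffunP => i; rewrite !ffunE addbK.
pose ext (x : cube k) : cube 4 :=
  [ffun j : 'I_4 => if insub (val j) is Some i then x i else true].
have extK x : restr (ext x) = x by apply/ffunP => i; rewrite !ffunE /= valK.
have linE (y : cube 4) : linear_form a y = linear_form w (flip (restr y)).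
  rewrite /linear_form (sum_widen_ord k4) => [|j /a_out ->]; last by rewrite mul0r.
  apply: eq_bigr => i _; rewrite a_widen !ffunE /neg /pm1.
  by case: (ltrP (w i) 0) => w0; [rewrite ltr0_norm|rewrite ger0_norm] => //;
    case: (y _) => /=; ring.
have a_ge0 j : 0 <= a j by rewrite /a; case: insub.
have a_nz (y : cube 4) : linear_form a y <> 0 by rewrite linE; exact: w_nz.
have [lam4 [[lam4_12 lam4_sat lam4_noisy] lam4_0]] := certificate_nonneg4 a_ge0 a_nz.
pose lam i : int := if neg i then - lam4 (widen_ord k4 i) else lam4 (widen_ord k4 i).
exists lam.
have lamE (x : cube k) : linear_form (fun i => (lam i)%:~R : R) x =
    linear_form (fun j => (lam4 j)%:~R : R) (ext (flip x)).
  rewrite /linear_form [RHS](sum_widen_ord k4) => [|j /a_out /lam4_0 ->].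
    apply: eq_bigr => i _; rewrite /lam !ffunE /= valK ffunE /pm1.
    by case: (neg i); case: (x i); rewrite /= ?rmorphN /=; ring.
  by rewrite mul0r.
have f_ext (x : cube k) : f x = (0 < linear_form a (ext (flip x))).
  by rewrite linE extK flipK fE addr0.
split => [|x|x].
- move: lam4_12; rewrite (sum_widen_ord (R := nat) k4) => [|j /a_out /lam4_0 -> //].
  by apply: leq_trans; apply: leq_sum => i _; rewrite /lam; case: ifP; rewrite ?abszN.
- by rewrite f_ext lamE; exact: lam4_sat.
rewrite lamE (le_trans (lam4_noisy _)) // ler_pM2l // lerD2r ler_pM2l //.
rewrite le_eqVlt; apply/orP; left; apply/eqP; rewrite /noisy.
pose G (y : cube k) : R := (f (flip y))%:R.
rewrite (eq_bigr (fun y : cube 4 => (\prod_j noise R (ext (flip x) j) (y j)) *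
    G [ffun i => y (widen_ord k4 i)])); last first.
  by move=> y _; rewrite linE /G fE addr0.
(* The noise on the padding coordinates sums out, and the flips cancel by [noise_addb]. *)
rewrite (sum_marginal G (p := fun j => noise R (ext (flip x) j)) (idx := widen_ord k4)).
- rewrite (reindex_inj (can_inj flipK)); apply: eq_bigr => y _; rewrite /G flipK.
  congr (_ * _); apply: eq_bigr => i _.
  by rewrite [flip y i]ffunE [ext _ _]ffunE /= valK ffunE noise_addb.
- by move=> i i' /(congr1 val) /= /val_inj.
- by move=> j; exact: sum_noise.
Qed.

(** * Sketching the l1 norm of the biases *)

Lemma Re_Zp_char_le1 (R : realType) (N : nat) (w : R[i]) (a : 'Z_N) :
  (1 < N)%N -> N.-primitive_root w -> `|complex.Re (Zp_char w a)| <= 1.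
Proof.
move=> N1 prim_w; have := add_Re2_Im2 (Zp_char w a).
rewrite Zp_char_norm // expr1n => /complexI ReIm1.
rewrite -(ler_pXn2r (n := 2)) ?nnegrE // real_normK ?num_real // expr1n.
by rewrite -ReIm1 lerDl sqr_ge0.
Qed.

(** With [S] the sum of the [x i], the product lies between [1 - S] and [1 / (1 + S)]; this avoids
    exponentials. *)
Lemma prod_1B_bounds (R : realFieldType) (I : finType) (x : I -> R) :
  (forall i, 0 <= x i <= 1) ->
  [/\ 0 <= \prod_i (1 - x i), \prod_i (1 - x i) <= 1,
      1 - \sum_i x i <= \prod_i (1 - x i) &
      (\prod_i (1 - x i)) * (1 + \sum_i x i) <= 1].
Proof.
move=> x01; suff [] : [/\ 0 <= \prod_i (1 - x i), \prod_i (1 - x i) <= 1,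
      0 <= \sum_i x i, 1 - \sum_i x i <= \prod_i (1 - x i) &
      (\prod_i (1 - x i)) * (1 + \sum_i x i) <= 1] by [].
elim/big_rec2: _ => [|i S P _ [P0 P1 S0 SP PS]]; first by split; lra.
have /andP[xi0 xi1] := x01 i; split; nra.
Qed.

Lemma le_sum_pred (R : numDomainType) (I : finType) (P Q : pred I) (F : I -> R) :
  (forall i, 0 <= F i) -> (forall i, P i -> Q i) ->
  \sum_(i | P i) F i <= \sum_(i | Q i) F i.
Proof.
move=> F0 PQ; rewrite big_mkcond [leRHS]big_mkcond; apply: ler_sum => i _.
by case: ifP => [/PQ -> //|_]; case: ifP.
Qed.

Lemma divn_gt_half (a m : nat) : (0 < m <= a)%N -> (a < (a %/ m * m).*2)%N.
Proof.
case/andP => m0 ma; rewrite {1}(divn_eq a m) -addnn ltn_add2l.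
by rewrite (leq_trans (ltn_pmod a m0)) // leq_pmull // divn_gt0.
Qed.

Definition l1_state (k n N r : nat) (lam : 'I_k -> int)
    (X : {ffun 'I_r -> {ffun 'I_n -> 'Z_N}}) (c : constraint k n) : 'rV['Z_N]_(r + 1) :=
  row_mx (\row_i \sum_j X i j * (bias lam [:: c] j)%:~R) (const_mx 1).

(** The cosine of [q] times the linear sketch, up to the choice of the primitive root [w]. *)
Definition l1_estimate (R : realType) (n N : nat) (w : R[i]) (z : 'I_n -> int) (q : nat)
    (X : {ffun 'I_n -> 'Z_N}) : R :=
  complex.Re (Zp_char w ((\sum_j X j * (z j)%:~R) * q%:R)).

(** The first [r] coordinates hold independent sketches, the last one counts
    constraints.  Scaling by [q], of order [2 ^ e / m], makes one choice of [X]
    serve all stream lengths [m <= 2 ^ e]. *)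
Definition l1_answer (R : realType) (N r e : nat) (w : R[i]) (g : 'rV['Z_N]_(r + 1)) : bool :=
  let m : nat := rsubmx g 0 0 in
  let q := (2 ^ e %/ m)%N in
  \sum_(i < r) complex.Re (Zp_char w (lsubmx g 0 i * q%:R))
    <= r%:R * (1 - (q * m)%:R / (32 * 2 ^ e)%:R * (8 / 5)).

Lemma bias_cat1 (k n : nat) (lam : 'I_k -> int) (Psi : seq (constraint k n)) j :
  bias lam Psi j = \sum_(c <- Psi) bias lam [:: c] j.
Proof. by apply: eq_bigr => c _; rewrite /bias big_seq1. Qed.

(** The state is linear in the stream, and the counter modulo [N] is exact because the stream is
    shorter than [N]. *)
Lemma l1_answer_sum (R : realType) (k n N r e : nat) (lam : 'I_k -> int) (w : R[i])
    (X : {ffun 'I_r -> {ffun 'I_n -> 'Z_N}}) (Psi : seq (constraint k n)) :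
  (1 < N)%N -> (size Psi < N)%N ->
  l1_answer e w (\sum_(c <- Psi) l1_state lam X c) =
  (\sum_(i < r) l1_estimate w (bias lam Psi) (2 ^ e %/ size Psi) (X i)
    <= r%:R * (1 - (2 ^ e %/ size Psi * size Psi)%:R / (32 * 2 ^ e)%:R * (8 / 5))).
Proof.
move=> N1 mN; rewrite /l1_answer.
have -> : nat_of_ord (rsubmx (\sum_(c <- Psi) l1_state lam X c) 0 0) = size Psi.
  rewrite raddf_sum summxE (eq_bigr (fun=> 1)) => [|c _].
    by rewrite big_const_seq count_predT iter_addr_0 val_Zp_nat // modn_small.
  by rewrite /l1_state /= row_mxKr mxE.
congr (_ <= _); apply: eq_bigr => i _; rewrite /l1_estimate; congr (complex.Re (Zp_char w (_ * _))).
rewrite raddf_sum summxE.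
under eq_bigr => c _ do rewrite /l1_state /= row_mxKl mxE.
rewrite exchange_big; apply: eq_bigr => j _.
by rewrite bias_cat1 rmorph_sum mulr_sumr.
Qed.

(** The mean is a product of factors [1 - x j] whose [x j] sum to [kappa] times the l1 norm over
    [m]. As [q * m] is within a factor 2 of [2 ^ e], [kappa] lies between 1/64 and 1/32. *)
Lemma l1_estimate_mean (R : realType) (n e : nat) (w : R[i]) (z : 'I_n -> int) (m : nat) :
  let N := (2 * (32 * 2 ^ e))%N in
  let W := (32 * 2 ^ e)%N in
  let q := (2 ^ e %/ m)%N in
  let kappa : R := (q * m)%:R / W%:R in
  let mean : R := \sum_(X : {ffun 'I_n -> 'Z_N}) (\prod_j fejer W w (X j)) * l1_estimate w z q X in
  N.-primitive_root w -> (0 < m <= 2 ^ e)%N -> (\sum_j `|z j| <= 12 * m)%N ->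
  [/\ 0 <= mean, mean <= 1, 1 / 64 <= kappa,
     (\sum_j `|z j|)%N%:R <= 3 / 2 * m%:R :> R -> 1 - 3 / 2 * kappa <= mean &
     9 / 5 * m%:R <= (\sum_j `|z j|)%N%:R :> R -> mean <= 1 - 17 / 10 * kappa].
Proof.
move=> N W q kappa mean prim_w m_bounds z_le; have /andP[m0 me] := m_bounds.
have e0 : (0 < 2 ^ e)%N by rewrite expn_gt0.
have W0 : (0 < W)%N by rewrite muln_gt0.
have W0' : 0 < W%:R :> R by rewrite ltr0n.
have qm_le : (q * m <= 2 ^ e)%N by exact: leq_divM.
have qm_gt := divn_gt_half m_bounds; rewrite -/q in qm_gt.
have zW (j : 'I_n) : (`|(q%:Z * z j)%R| <= W)%N.
  rewrite abszM /= (@leq_trans (q * (12 * m))%N) //.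
    by rewrite leq_mul2l (leq_trans _ z_le) ?orbT // (bigD1 j) //= leq_addr.
  by rewrite mulnCA /W leq_mul.
pose x (j : 'I_n) : R := `|(q%:Z * z j)%R|%:R / W%:R.
have meanE : mean = \prod_j (1 - x j).
  rewrite -(fejer_expectation (N := N) (mul2n W) W0 prim_w zW).
  apply: eq_bigr => X _; rewrite /l1_estimate mulr_suml.
  congr (_ * complex.Re (Zp_char w _)); apply: eq_bigr => j _.
  by rewrite rmorphM /= -mulrA [X in _ = _ * X]mulrC.
have x01 j : 0 <= x j <= 1.
  by rewrite divr_ge0 //= ler_pdivrMr // mul1r ler_nat.
have [P0 P1 SP PS] := prod_1B_bounds x01.
have sum_x : \sum_j x j * m%:R = kappa * (\sum_j `|z j|)%N%:R.
  rewrite /x /kappa natr_sum mulr_sumr; apply: eq_bigr => j _.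
  by rewrite abszM /= !natrM; ring.
rewrite -mulr_suml in sum_x.
have m0' : 0 < m%:R :> R by rewrite ltr0n.
have kappa_le : kappa <= 1 / 32.
  rewrite ler_pdivrMr // /W [in leRHS]natrM.
  have : (q * m)%:R <= (2 ^ e)%:R :> R by rewrite ler_nat.
  lra.
have kappa_ge : 1 / 64 <= kappa.
  rewrite ler_pdivlMr // /W [in leLHS]natrM.
  have : (2 ^ e)%:R <= ((q * m).*2)%:R :> R by rewrite ler_nat ltnW.
  rewrite -mul2n natrM; lra.
rewrite meanE; split => // [S_le|S_ge].
  have : \sum_j x j <= 3 / 2 * kappa by rewrite -(ler_pM2r m0') sum_x; nra.
  lra.
have : 9 / 5 * kappa <= \sum_j x j by rewrite -(ler_pM2r m0') sum_x; nra.
move: (\prod_j _) (\sum_j _) P0 P1 SP PS => P S P0 P1 SP PS S_ge'.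
(* [(1 + 9/5 * kappa) * (1 - 17/10 * kappa) >= 1] holds since [kappa <= 1/32]. *)
rewrite leNgt; apply/negP => P_gt; nra.
Qed.

(** The threshold 8/5 is 1/10 away from both 3/2 and 17/10, so an error needs an average deviation
    of [kappa / 10 >= 1 / 640]. With squares bounded by 4, Chebyshev gives
    [4 * 640 ^ 2 / r <= 1 / 14]. *)
Lemma l1_answer_error (R : realType) (n e r m : nat) (w : R[i]) (z : 'I_n -> int) :
  let N := (2 * (32 * 2 ^ e))%N in
  let W := (32 * 2 ^ e)%N in
  let q := (2 ^ e %/ m)%N in
  let accept (X : {ffun 'I_r -> {ffun 'I_n -> 'Z_N}}) :=
    \sum_(i < r) l1_estimate w z q (X i) <= r%:R * (1 - (q * m)%:R / W%:R * (8 / 5)) in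
  let weight (X : {ffun 'I_r -> {ffun 'I_n -> 'Z_N}}) : R :=
    \prod_i \prod_j fejer W w (X i j) in
  N.-primitive_root w -> (0 < m <= 2 ^ e)%N -> (\sum_j `|z j| <= 12 * m)%N ->
  56 * 640 ^+ 2 <= r%:R :> R ->
  ((\sum_j `|z j|)%N%:R <= 3 / 2 * m%:R :> R ->
     \sum_(X | accept X) weight X <= 1 / 14) /\
  (9 / 5 * m%:R <= (\sum_j `|z j|)%N%:R :> R ->
     \sum_(X | ~~ accept X) weight X <= 1 / 14).
Proof.
move=> N W q accept weight prim_w m_bounds z_le r_ge.
have W0 : (0 < W)%N by rewrite muln_gt0 expn_gt0.
have N1 : (1 < N)%N by rewrite /N -/W; lia.
have r0 : 0 < r%:R :> R by lra.
have [] := l1_estimate_mean prim_w m_bounds z_le.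
rewrite -/q -/W -/N; set mean := \sum_X _; set kappa := _%:R / _%:R.
move=> mean0 mean1 kappa_ge mean_low mean_high.
pose mu (X : {ffun 'I_n -> 'Z_N}) : R := \prod_j fejer W w (X j).
pose h (X : {ffun 'I_n -> 'Z_N}) : R := l1_estimate w z q X - mean.
have mu0 X : 0 <= mu X by apply: prodr_ge0 => j _; exact: fejer_ge0.
have mu1 : \sum_X mu X = 1.
  by apply: sum_prod_weights; exact: (sum_fejer (mul2n W)).
have h0 : \sum_X mu X * h X = 0.
  under eq_bigr => X _ do rewrite mulrBr.
  by rewrite sumrB -mulr_suml mu1 mul1r subrr.
have h4 X : h X ^+ 2 <= 4.
  have := Re_Zp_char_le1 ((\sum_j X j * (z j)%:~R) * q%:R) N1 prim_w.
  by rewrite -/(l1_estimate w z q X) ler_norml /h => /andP[? ?]; nra.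
have sum_h (X : {ffun 'I_r -> {ffun 'I_n -> 'Z_N}}) :
    \sum_i h (X i) = \sum_i l1_estimate w z q (X i) - r%:R * mean.
  by rewrite sumrB sumr_const card_ord mulr_natl.
have dev_le (P : pred {ffun 'I_r -> {ffun 'I_n -> 'Z_N}}) :
    (forall X, P X -> r%:R / 640 <= `|\sum_i h (X i)|) ->
    \sum_(X | P X) weight X <= 1 / 14.
  move=> P_dev; apply: le_trans (le_sum_pred _ P_dev) _.
    by move=> X; apply: prodr_ge0 => i _; exact: mu0.
  have d0 : 0 < r%:R / 640 :> R by lra.
  apply: le_trans (chebyshev_copies 'I_r mu0 mu1 h0 h4 d0) _.
  rewrite card_ord ler_pdivrMr ?exprn_gt0 //.
  have : 56 * 640 ^+ 2 * r%:R <= r%:R * r%:R :> R by rewrite ler_pM2r.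
  lra.
split=> [S_le|S_ge]; apply: dev_le => X; rewrite /accept -/kappa.
  move=> acc; rewrite sum_h ler_normr; apply/orP; right.
  have := ler_wpM2l (ltW r0) (mean_low S_le).
  have := ler_wpM2l (ltW r0) kappa_ge; lra.
rewrite -ltNge => rej; rewrite sum_h ler_normr; apply/orP; left.
have := ler_wpM2l (ltW r0) (mean_high S_ge).
have := ler_wpM2l (ltW r0) kappa_ge; lra.
Qed.

(** * Derandomization and assembly of the algorithm *)

Lemma pmap_onth_iota (T : Type) (s : seq T) (M : nat) :
  (size s <= M)%N -> pmap (onth s) (iota 0 M) = s.
Proof.
elim: s M => [|x s IH] M; first by move=> _; elim: (iota 0 M) => //= i l ->; case: i.
case: M => // M /IH sE; rewrite /= -[RHS]/(x :: s) -[in RHS]sE (iotaDl 1 0).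
by congr (_ :: _); elim: (iota 0 M) => //= i l ->.
Qed.

Lemma exists_sketching_algorithm (R : realType) (k n : nat) (f : cube k -> bool)
    (lam : 'I_k -> int) (M e r t : nat) :
  balancedLTF R f -> certificate R f lam -> (M <= 2 ^ e)%N ->
  56 * 640 ^+ 2 <= r%:R :> R ->
  (#|{: constraint k n}|.+1 ^ M)%:R * 3 ^+ (2 ^ t) < 4 ^+ (2 ^ t) :> R ->
  exists A : sketching_algorithm k n,
    alg_space A = (t + (e + 6) * (r + 1))%N /\
    solves f (1 - 1 / 1000) (rho R f + 1 / 1000) M A.
Proof.
move=> hf cert Me r_ge card_lt; pose W := (32 * 2 ^ e)%N; pose N := (2 * W)%N.
have [lam12 _ _] := cert.
have NE : N = (2 ^ (e + 5).+1)%N by rewrite /N /W expnS expnD [(2 ^ e * _)%N]mulnC.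
have [w prim_w] := exists_primitive_root_pow2 R[i] (e + 5); rewrite -NE in prim_w.
have W0 : (0 < W)%N by rewrite muln_gt0 expn_gt0.
have N1 : (1 < N)%N by rewrite /N; lia.
have MN : (M < N)%N by apply: leq_ltn_trans Me _; rewrite /N /W; have := expn_gt0 2 e; lia.
(* Streams of length at most [M] are coded by a finite type, as [newman] requires; [None] marks an
   empty slot. *)
pose stream (b : {ffun 'I_M -> option (constraint k n)}) : seq (constraint k n) :=
  pmap b (enum 'I_M).
have stream_onto Psi : (size Psi <= M)%N -> exists b, stream b = Psi.
  move=> sz; exists [ffun i : 'I_M => onth Psi i].
  rewrite /stream; apply: (@eq_trans _ _ (pmap (onth Psi) (iota 0 M))).
    by rewrite -val_enum_ord; elim: (enum _) => //= i s ->; rewrite ffunE.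
  exact: pmap_onth_iota.
pose Om : finType := {ffun 'I_r -> {ffun 'I_n -> 'Z_N}}.
pose mu (X : Om) : R := \prod_i \prod_j fejer W w (X i j).
pose out (X : Om) Psi := l1_answer e w (\sum_(c <- Psi) l1_state lam X c).
pose wrong (Psi : seq (constraint k n)) (X : Om) : bool := (0 < size Psi <= M)%N &&
  ((1 - 1 / 1000 <= csp_val R f Psi) && ~~ out X Psi ||
   (csp_val R f Psi < rho R f + 1 / 1000) && out X Psi).
have mu0 X : 0 <= mu X.
  by apply: prodr_ge0 => i _; apply: prodr_ge0 => j _; exact: fejer_ge0.
have mu1 : \sum_X mu X = 1.
  apply: (sum_prod_weights _ (mu := fun X : {ffun 'I_n -> 'Z_N} => \prod_j fejer W w (X j))).
  by apply: sum_prod_weights; exact: (sum_fejer (mul2n W)).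
have wrong_le Psi : \sum_(X | wrong Psi X) mu X <= 1 / 14.
  rewrite /wrong; have [/andP[m0 mM]|_] := boolP (0 < size Psi <= M)%N; last first.
    by rewrite big_pred0_eq; lra.
  have z_le : (\sum_j `|bias lam Psi j| <= 12 * size Psi)%N.
    by apply: leq_trans (bias_norm _ _) _; rewrite leq_mul2r lam12 orbT.
  have m_bounds : (0 < size Psi <= 2 ^ e)%N by rewrite m0 (leq_trans mM).
  have [low high] := l1_answer_error prim_w m_bounds z_le r_ge.
  have outE X : out X Psi = _ := l1_answer_sum e lam w X N1 (leq_ltn_trans mM MN).
  (* With [eps = 1 / 1000], [2 - 14 * eps >= 9 / 5] and [4 / 3 + 36 * eps <= 3 / 2]. *)
  have [val_hi|_] := boolP (1 - 1 / 1000 <= csp_val R f Psi).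
    have S_ge := bias_high_val cert m0 val_hi.
    have m0' : 0 < (size Psi)%:R :> R by rewrite ltr0n.
    have rho_lt : (csp_val R f Psi < rho R f + 1 / 1000) = false.
      by apply/negbTE; rewrite -leNgt (rho_balancedLTF hf); lra.
    apply: le_trans (high _); last by nra.
    by apply: le_sum_pred => // X; rewrite rho_lt /= orbF outE.
  have [val_lo|_] := boolP (csp_val R f Psi < rho R f + 1 / 1000); last first.
    by rewrite big_pred0_eq; lra.
  rewrite (rho_balancedLTF hf) in val_lo; have S_le := bias_low_val cert m0 val_lo.
  have m0' : 0 < (size Psi)%:R :> R by rewrite ltr0n.
  apply: le_trans (low _); last by nra.
  by apply: le_sum_pred => // X; rewrite outE.
have [|om om_good] := newman (J := t.-tuple bool)
    (bad := fun b : {ffun 'I_M -> option (constraint k n)} => wrong (stream b))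
    mu0 mu1 (fun b => wrong_le (stream b)).
  by rewrite card_tuple card_bool card_ffun card_option card_ord.
have card_state : (#|'rV['Z_N]_(r + 1)| <= 2 ^ ((e + 6) * (r + 1)))%N.
  by rewrite card_mx mul1n card_ord Zp_cast // NE -expnM -addnS.
have [A [A_space A_out]] := linear_sketching_algorithm
  (fun s c => l1_state lam (om s) c) (fun=> l1_answer e w) card_state.
exists A; split=> // Psi sz; have /andP[m0 mM] := sz.
have [b bE] := stream_onto _ mM; have := om_good b; rewrite bE => few_wrong.
have prob_ge (v : bool) :
    (forall s, (out (om s) Psi != v) -> wrong Psi (om s)) ->
    2 / 3 <= prob_output R A Psi v.
  move=> wrongP; rewrite A_out ler_pdivlMr ?exprn_gt0 //.
  set G := [pred s | _ == v].
  have : (#|[predC G]| <= #|[pred s | wrong Psi (om s)]|)%N.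
    by apply: subset_leq_card; apply/fintype.subsetP => s; rewrite !inE => /wrongP.
  have := cardC G; rewrite card_tuple card_bool => cardG bad_le.
  have : (2 * 2 ^ t <= 3 * #|G|)%N.
    rewrite card_tuple card_bool in few_wrong.
    have count (g b' c d : nat) :
      (g + b' = d -> b' <= c -> c * 3 <= d -> 2 * d <= 3 * g)%N by lia.
    exact: count cardG bad_le few_wrong.
  rewrite -(ler_nat R) !natrM natrX; lra.
split=> [val_hi|val_lo]; apply: prob_ge => s; rewrite /wrong sz /=.
  by move/negbTE; rewrite eqb_id => ->; rewrite val_hi.
by rewrite val_lo eqbF_neg negbK => ->; rewrite orbT.
Qed.

(** * Space *)

Lemma leq_expl (a b c : nat) : (a <= b -> a ^ c <= b ^ c)%N.
Proof. by case: c => // c; rewrite leq_exp2r. Qed.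

Lemma card_constraint (k n : nat) : (#|{: constraint k n}| <= (2 * n) ^ k)%N.
Proof.
rewrite card_sig (leq_trans (max_card _)) // card_ffun card_prod !card_ord card_bool.
by rewrite mulnC.
Qed.

(** There are at most [2 ^ D] codes, [D = 2 ^ (l + e + 3)], against [4 * D] seeds, and
    [2 * 3 ^ 4 = 162 < 256 = 4 ^ 4]. *)
Lemma card_streams (R : realFieldType) (k n l e : nat) :
  (k <= 4)%N -> (n < 2 ^ l)%N ->
  forall M, (M <= 2 ^ e)%N ->
  (#|{: constraint k n}|.+1 ^ M)%:R * 3 ^+ (2 ^ (l + e + 5))
    < 4 ^+ (2 ^ (l + e + 5)) :> R.
Proof.
move=> k4 nl M Me.
have C_le : (#|{: constraint k n}|.+1 <= 2 ^ (2 ^ (l + 3)))%N.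
  apply: (@leq_trans (2 ^ (4 * l + 4)).+1).
    rewrite ltnS (leq_trans (card_constraint k n)) //.
    apply: (@leq_trans ((2 ^ l.+1) ^ k)).
      by rewrite leq_expl // expnS leq_mul2l ltnW.
    by rewrite -expnM leq_exp2l // mulSn; nia.
  apply: (@leq_trans (2 ^ (4 * l + 5))).
    have -> : (4 * l + 5 = (4 * l + 4).+1)%N by lia.
    by have := expn_gt0 2 (4 * l + 4); rewrite expnS; lia.
  rewrite leq_exp2l // expnD.
  by have := ltn_expl l (isT : (1 < 2)%N); lia.
pose D := (2 ^ (l + e + 3))%N.
have T_eq : (2 ^ (l + e + 5) = 4 * D)%N by rewrite /D [in LHS](addnA _ 3 2) expnD mulnC.
have S_le : (#|{: constraint k n}|.+1 ^ M <= 2 ^ D)%N.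
  apply: (@leq_trans ((2 ^ (2 ^ (l + 3))) ^ (2 ^ e))).
    apply: (@leq_trans (#|{: constraint k n}|.+1 ^ (2 ^ e))); first by rewrite leq_pexp2l.
    exact: leq_expl.
  by rewrite -expnM -expnD /D addnAC.
have D0 : (0 < D)%N by rewrite expn_gt0.
rewrite -!natrX -natrM ltr_nat T_eq !expnM.
apply: (@leq_ltn_trans ((2 * 3 ^ 4) ^ D)); first by rewrite expnMn leq_mul2r S_le orbT.
by rewrite ltn_exp2r.
Qed.

Lemma linear_log_eqO (R : realType) (s : nat -> nat) (K : nat) :
  (forall n, (s n <= K * (trunc_log 2 n).+1)%N) ->
  (fun n => (s n)%:R : R) =O_\oo (fun n : nat => ln (n%:R : R)).
Proof.
move=> s_le; have ln2 : 0 < ln (2 : R) by rewrite ln_gt0 // ltr1n.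
(* The factor 2 absorbs the successor of the logarithm once [n >= 2]; [K.+1] keeps the constant
   positive. *)
apply/eqO_exP; exists (K.+1%:R * 2 / ln 2); first by rewrite divr_gt0 // mulr_gt0.
near=> n.
have n2 : (2 <= n)%N by near: n; exact: nbhs_infty_ge.
have n1 : 1 < n%:R :> R by rewrite ltr1n.
have log_gt0 : (0 < trunc_log 2 n)%N by rewrite trunc_log_gt0.
have log_le : (trunc_log 2 n)%:R * ln 2 <= ln n%:R :> R.
  rewrite mulrC mulr_natr -lnXn // ler_ln ?posrE ?exprn_gt0 ?(lt_trans _ n1) //.
  by rewrite -natrX ler_nat trunc_logP // ltnW.
rewrite normr_nat (ger0_norm (ltW (ln_gt0 n1))) mulrAC ler_pdivlMr //.
apply: (@le_trans _ _ (K.+1%:R * 2 * ((trunc_log 2 n)%:R * ln 2))); last first.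
  by rewrite ler_wpM2l.
rewrite mulrA (ler_wpM2r (ltW ln2)) // -!natrM ler_nat (leq_trans (s_le n)) //.
by rewrite -mulnA leq_mul // mul2n -addnn -addn1 leq_add2l.
Unshelve. all: by end_near.
Qed.

Theorem theorem1p4 (R : realType) (k : nat) (f : cube k -> bool)
    (hk : (k <= 4)%N) (hf : balancedLTF R f) :
  sketching_approximable_O f (fun n : nat => ln (n%:R : R)).
Proof.
have [lam cert] := exists_certificate hk hf.
exists (1 / 1000); split; [lra | by rewrite (rho_balancedLTF hf); lra | move=> c].
(* The number of copies depends neither on [n] nor on [c]. *)
have [r r_ge] : exists r, 56 * 640 ^+ 2 <= r%:R :> R.
  by eexists; apply/ltW/archi_boundP; lra.
pose l n := (trunc_log 2 n).+1.
(* Chosen from [c <= 2 ^ c] and [n ^ c <= 2 ^ (c * l n)]. *)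
pose e n := (c * l n + c)%N.
pose t n := (l n + e n + 5)%N.
have n_lt n : (n < 2 ^ l n)%N by exact: trunc_log_ltn.
have M_le n : (c * n ^ c <= 2 ^ e n)%N.
  rewrite /e expnD mulnC leq_mul ?(ltnW (ltn_expl _ _)) // mulnC expnM.
  by rewrite leq_expl // ltnW.
exists (fun n => t n + (e n + 6) * (r + 1))%N; split.
  apply: (@linear_log_eqO R _ (2 * c + 6 + (2 * c + 6) * (r + 1))) => n /=.
  rewrite -/(l n) [leqRHS]mulnDl leq_add //.
    by rewrite /t /e; have : (0 < l n)%N by []; nia.
  rewrite mulnAC leq_mul2r; apply/orP; right.
  by rewrite /e; have : (0 < l n)%N by []; nia.
have A_ex n : exists A : sketching_algorithm k n,
    alg_space A = (t n + (e n + 6) * (r + 1))%N /\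
    solves f (1 - 1 / 1000) (rho R f + 1 / 1000) (c * n ^ c) A.
  apply: (exists_sketching_algorithm hf cert (M_le n) r_ge).
  exact: (card_streams R hk (n_lt n) (M_le n)).
exists (fun n => sval (cid (A_ex n))) => n.
by case: (cid (A_ex n)) => A [/= -> A_solves].
Qed.
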